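(* Let $X,Y$ be completely regular realcompact spaces, let $E,F$ be normed spaces, and let $T:C_{b}(X,E)\rightarrow C_{b}(Y,F)$ be a biseparating map. If $Y$ has no isolated points, then $T$ is continuous.
   Context: Normed spaces are over the same scalar field, either $\mathbb{R}$ or $\mathbb{C}$ (the result is for both cases). Normed spaces are not assumed complete. Completely regular spaces are understood to be Hausdorff. For a completely regular space $X$ and a normed space $E$, $C(X,E)$ denotes the space of all continuous functions from $X$ into $E$ ($C(X)$ when $E$ is the scalar field), and $C_b(X,E)$ denotes the space of all bounded continuous functions from $X$ into $E$, equipped with the topology of uniform convergence on $X$ (i.e. the sup norm). Realcompact: let $\beta X$ be the maximal (Stone–Čech) compactification of $X$. Each $f\in C(X)$ extends continuously to $\beta X$ if the value $\infty$ is allowed. The realcompactification $rX$ is the set of all points of $\beta X$ at which the extension of every $f\in C(X)$ is finite; $X$ is realcompact if $rX=X$. Let $A$ be a space of continuous $E$-valued functions on $X$ and $B$ a space of continuous $F$-valued functions on $Y$. A linear map $T:A\to B$ is separating if, for all $f,g\in A$, $\|f(x)\|\,\|g(x)\|=0$ for all $x\in X$ implies $\|(Tf)(y)\|\,\|(Tg)(y)\|=0$ for all $y\in Y$. It is biseparating if it is separating, $T$ is a bijection from $A$ onto $B$, and $T^{-1}$ is also separating. *)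

(* Defs.v *)
From HB Require Import structures.
From mathcomp Require Import all_boot all_order all_algebra.
From mathcomp Require Import all_classical all_reals all_analysis.
From mathcomp Require Import complex.

Set Implicit Arguments.
Unset Strict Implicit.
Unset Printing Implicit Defensive.

Import Order.TTheory GRing.Theory Num.Theory.
Import numFieldTopology.Exports numFieldNormedType.Exports.

Local Open Scope classical_set_scope.
Local Open Scope ring_scope.

Variant real_or_complex (R : realType) : numFieldType -> Prop :=
| RealScalars : real_or_complex R R
| ComplexScalars : real_or_complex R R[i].

(* The Stone-Cech compactification is built as the closure of the image of X
   in the product of copies of [0, 1] indexed by C(X, [0, 1]).  The factors are
   typed as R; the coordinates of points of the closure stay in [0, 1].  The
   properties characterizing it as the maximal compactification of a completely
   regular Hausdorff space follow the definition. *)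
Section StoneCech.
Context {R : realType} {X : topologicalType}.

Definition unit_functions : set (X -> R) :=
  [set f : X -> R | continuous f /\ forall x, 0 <= f x <= 1].

Definition cube_map (x : X) : prod_topology (fun _ : unit_functions => R) :=
  fun f => set_val f x.

Definition stone_cech : Type := set_type (closure (range cube_map)).

HB.instance Definition _ := Topological.on stone_cech.

Definition stone_cech_map (x : X) : stone_cech :=
  SigSub (mem_set (subset_closure (imageT cube_map x))).

End StoneCech.
Arguments stone_cech R X : clear implicits.
Arguments stone_cech_map R X x : clear implicits.

Lemma completely_regular_separation {R : realType} {Z : topologicalType}
    (z : Z) (U : set Z) : completely_regular_space Z -> nbhs z U ->
  exists2 f : @unit_functions R Z,
    set_val f z = 0 & forall y, set_val f y < 1 -> U y.
Proof.
move=> crZ; rewrite nbhsE => -[V [oV Vz] VU].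
have /(@uniform_separatorP _ R)[f [cf f01 f0 f1]] :=
  crZ z (~` V) (open_closedC oV) (fun nV => nV Vz).
have uf : f \in @unit_functions R Z.
  apply/mem_set; split => // y.
  by have := f01 _ (imageT f y); rewrite /= in_itv.
exists (SigSub uf) => /=; first by apply: f0; exists z.
move=> y fy; apply: VU; apply: contrapT => nVy.
have fy1 : f y = 1 by apply: f1; exists y.
by have : f y < 1 := fy; rewrite fy1 ltxx.
Qed.

Section StoneCechTheory.
Context {R : realType} {X : topologicalType}.
Local Notation stone_cech := (stone_cech R X).
Local Notation eta := (stone_cech_map R X).
Local Notation J := (@unit_functions R X).
Local Notation P := (prod_topology (fun _ : J => R)).

Let val_cts : continuous (set_val : stone_cech -> P).
Proof. exact: initial_continuous. Qed.

Lemma stone_cech_coord_continuous (f : J) :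
  continuous (fun p : stone_cech => (set_val p : P) f).
Proof.
move=> p; apply: (@continuous_comp stone_cech P R set_val (fun q : P => q f)).
  exact: val_cts.
exact: (@proj_continuous _ (fun=> R) f).
Qed.

Lemma stone_cech_map_continuous : continuous eta.
Proof.
apply: (@continuous_comp_initial _ _ _ (set_val : stone_cech -> P) eta) => x.
apply/cvg_sup => f U [_ [[W oW <-] /= Wx] /filterS]; apply.
have /set_mem[cf _] := valP f.
by apply: cf; apply: open_nbhs_nbhs; split.
Qed.

Lemma stone_cech_map_dense : dense (range eta).
Proof.
move=> O [p Op] [W oW WO].
have /set_mem clp := valP p.
have [|q [[x _ <-] Wq]] := clp W.
  by apply: open_nbhs_nbhs; split => //; rewrite -WO in Op.
by exists (eta x); split; [rewrite -WO|exists x].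
Qed.

Lemma stone_cech_hausdorff : hausdorff_space stone_cech.
Proof.
have hP : hausdorff_space P.
  by apply: hausdorff_product => _; exact: Rhausdorff.
move=> p q pq; apply: val_inj; apply: hP => A B nA nB.
have [r [rA rB]] := pq _ _ (val_cts nA) (val_cts nB).
by exists (set_val r).
Qed.

Lemma closure_unit : closure (range (@cube_map R X)) `<=` [set q : P | forall f, 0 <= q f <= 1].
Proof.
have -> : [set q : P | forall f, 0 <= q f <= 1] =
   \bigcap_(f in [set: J]) ((fun q : P => q f) @^-1` `[0, 1]).
  apply/seteqP; split=> [q h f _|q h f]; first by rewrite /= in_itv/= h.
  by have := h f I; rewrite /= in_itv.
rewrite closureE; apply: smallest_sub.
  apply: closed_bigI => f _; apply: closed_comp; last exact: interval_closed.
  by move=> + _; exact: (@proj_continuous _ (fun=> R) f).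
by move=> _ [x _ <-] f _; have /set_mem[_ h] := valP f; rewrite /= in_itv/= h.
Qed.

Lemma stone_cech_compact : compact [set: stone_cech].
Proof.
have cc : @compact P (closure (range (@cube_map R X))).
  apply: (subclosed_compact _ _ closure_unit); first exact: closed_closure.
  have := @tychonoff J (fun=> R) (fun=> `[0, 1]%classic) (fun=> @segment_compact R 0 1).
  congr compact; apply/seteqP; split => q /= h f; have := h f;
  by rewrite in_itv.
move=> G PG _.
have [|q [clq Gq]] := cc ((set_val : stone_cech -> P) @ G) _.
- by apply: (@filterS _ G _ setT); [move=> p _; exact: (set_mem (valP p))|exact: filterT].
exists (SigSub (mem_set clq)); split => // A B GA [_ [[W oW <-] /= Wq WB]].
have [||r [[s As sr] Wr]] := Gq (set_val @` A) W.
- by apply: (@filterS _ G _ A _ _ GA) => s As; exists s.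
- exact: open_nbhs_nbhs.
by exists s; split => //; apply: WB; rewrite /= sr.
Qed.

Lemma stone_cech_map_embedding : hausdorff_space X -> completely_regular_space X ->
  injective eta /\ @open X = @open (initial_topology eta).
Proof.
move=> hX crX.
have sep := fun x U => @completely_regular_separation R X x U crX.
split.
- move=> x y xy; apply: hX => A B nA nB.
  have [f f0 fA] := sep x A nA; exists y; split; last exact: nbhs_singleton.
  apply: fA; have fxy : set_val f x = set_val f y.
    exact: (congr1 (fun p : stone_cech => (set_val p : P) f) xy).
  by rewrite -fxy f0.
- apply/seteqP; split => U; last first.
    by move=> [V oV <-]; apply: open_comp => // + _; exact: stone_cech_map_continuous.
  move=> oU; rewrite openE => x Ux.
  have [f f0 fU] := sep x U (open_nbhs_nbhs (conj oU Ux)).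
  exists (eta @^-1` [set p : stone_cech | (set_val p : P) f < 1]); split.
  + exists [set p : stone_cech | (set_val p : P) f < 1] => //.
    apply: (@open_comp _ _ (fun p : stone_cech => (set_val p : P) f) [set r | r < 1]); last exact: open_lt.
    by move=> + _; exact: stone_cech_coord_continuous.
  + by have : set_val f x < 1 by rewrite f0.
  + exact: fU.
Qed.

Lemma stone_cech_extension (Z : topologicalType) (g : X -> Z) :
  compact [set: Z] -> hausdorff_space Z -> continuous g ->
  exists2 G : stone_cech -> Z, continuous G & forall x, G (eta x) = g x.
Proof.
move=> cZ hZ cg.
have nZ := compact_normal hZ cZ.
have crZ : completely_regular_space Z.
  apply: (@normal_completely_regular R) => //; exact: hausdorff_accessible.
have sep := fun z U => @completely_regular_separation R Z z U crZ.
pose JZ := @unit_functions R Z.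
have Jg (h : JZ) : (set_val h \o g) \in J.
  have /set_mem[ch h01] := valP h.
  by apply/mem_set; split => [x|x]; [apply: continuous_comp; [exact: cg|exact: ch]|exact: h01].
pose c (p : stone_cech) (h : JZ) : R := (set_val p : P) (SigSub (Jg h)).
have ex p : exists z, forall h : JZ, set_val h z = c p h.
  have /set_mem clp := valP p.
  pose F := filter_from (nbhs (set_val p : P)) (fun V => g @` (@cube_map R X @^-1` V)).
  have PF : ProperFilter F.
    apply: filter_from_proper; last first.
      by move=> V /clp[q [[x _ <-] Vx]]; exists (g x), x.
    apply: filter_from_filter; first by exists setT; exact: filterT.
    move=> V W nV nW; exists (V `&` W); first exact: filterI.
    by move=> _ [x [Vx Wx] <-]; split; exists x.
  have [z [_ zF]] := cZ F PF filterT.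
  exists z => h; have /set_mem[ch _] := valP h.
  apply: Rhausdorff => A B nA nB.
  have [||z' [[x xB <-] Ax]] := zF (g @` (@cube_map R X @^-1` ((fun q : P => q (SigSub (Jg h))) @^-1` B))) (set_val h @^-1` A).
  - by exists ((fun q : P => q (SigSub (Jg h))) @^-1` B) => //; exact: (@proj_continuous _ (fun=> R)).
  - exact: ch.
  - by exists (set_val h (g x)).
pose G p := sval (cid (ex p)).
have GE p h : set_val h (G p) = c p h by exact: (svalP (cid (ex p))).
exists G.
  move=> p U nU; have [h h0 hU] := sep _ _ nU.
  have := @stone_cech_coord_continuous (SigSub (Jg h)) p.
  move=> /(_ [set r | r < 1]) H.
  have : nbhs p [set q : stone_cech | c q h < 1].
    apply: H; apply: open_nbhs_nbhs; split; first exact: open_lt.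
    by have : c p h < 1 by rewrite -GE h0.
  by apply: filterS => q qh; apply: hU; rewrite GE.
move=> x; apply: hZ => A B nA nB.
have [h h0 hA] := sep _ _ nA; exists (g x); split; last exact: nbhs_singleton.
by apply: hA; have <- : set_val h (G (eta x)) = set_val h (g x) := GE (eta x) h; rewrite h0.
Qed.
End StoneCechTheory.

Section Realcompact.
Context (R : realType) (K : numFieldType) (X : topologicalType).

(* The value oo is the added point None of the one-point compactification of
   K, whose single point at infinity serves both for R and for C.  When K is
   locally compact, an extension F of f exists by stone_cech_extension and is
   unique by density of X. *)
Definition realcompactification : set (stone_cech R X) :=
  [set p | forall (f : X -> K)
             (F : stone_cech R X -> one_point_compactification K),
     continuous f -> continuous F ->
     (forall x, F (stone_cech_map R X x) = Some (f x)) ->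
     F p <> None].

Definition realcompact : Prop :=
  realcompactification = range (stone_cech_map R X).

End Realcompact.

Section BoundedContinuous.
Context {K : numFieldType} (X : topologicalType) (E : normedModType K).

Definition bounded_continuous : {pred X -> E} :=
  mem [set f : X -> E | continuous f /\ bounded_fun f].

Record Cb := MkCb { Cb_val :> X -> E; _ : Cb_val \in bounded_continuous }.

HB.instance Definition _ := [isSub for Cb_val].
HB.instance Definition _ := [Choice of Cb by <:].

Let bounded_continuous_submod : subsemimod_closed bounded_continuous.
Proof.
split; [split|].
- by apply/mem_set; split; [move=> x; exact: cvg_cst|exact: bounded_cst].
- move=> f g /set_mem[cf bf] /set_mem[cg bg]; apply/mem_set; split.
    by move=> x; exact: continuousD (cf x) (cg x).
  have [M M0 fM] := ex_strict_bound_gt0 bf.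
  have [N N0 gN] := ex_strict_bound_gt0 bg.
  exists (M + N); split; first by rewrite realD// gtr0_real.
  move=> r /ltW MNr x _ /=; apply: le_trans MNr.
  by rewrite (le_trans (ler_normD _ _))// lerD// ltW//; [exact: fM|exact: gN].
- move=> a f /set_mem[cf bf]; apply/mem_set; split.
    by move=> x; exact: continuousZl_tmp (cf x).
  have [M M0 fM] := ex_strict_bound_gt0 bf.
  exists (`|a| * M); split; first by rewrite realM// ?normr_real// gtr0_real.
  move=> r /ltW aMr x _ /=; apply: le_trans aMr.
  by rewrite normrZ ler_wpM2l// ltW//; exact: fM.
Qed.

HB.instance Definition _ :=
  GRing.isSubmodClosed.Build K (X -> E) bounded_continuous
    bounded_continuous_submod.
HB.instance Definition _ := [SubChoice_isSubLmodule of Cb by <:].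

(* Topology of uniform convergence on X, i.e. of the sup norm. *)
HB.instance Definition _ :=
  Uniform.copy Cb (initial_topology (Cb_val : Cb -> {uniform X -> E})).

End BoundedContinuous.

Section Separating.
Context {K : numFieldType} {X Y : topologicalType} {E F : normedModType K}.

Definition separating (T : Cb X E -> Cb Y F) : Prop :=
  forall f g : Cb X E,
    (forall x, `|f x| * `|g x| = 0) -> forall y, `|T f y| * `|T g y| = 0.

End Separating.

(* S is T^-1; it is automatically linear. *)
Definition biseparating {K : numFieldType} {X Y : topologicalType}
    {E F : normedModType K} (T : {linear Cb X E -> Cb Y F}) : Prop :=
  separating T /\
  exists S : Cb Y F -> Cb X E, [/\ cancel T S, cancel S T & separating S].

(* Main.v *)
Require Import Defs.
From mathcomp Require Import all_boot all_order all_algebra.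
From mathcomp Require Import all_classical all_reals all_analysis.
From mathcomp Require Import complex ring lra.
Import Order.TTheory GRing.Theory Num.Theory.
Import numFieldTopology.Exports numFieldNormedType.Exports.
Set Implicit Arguments.
Unset Strict Implicit.
Unset Printing Implicit Defensive.
Local Open Scope classical_set_scope.
Local Open Scope ring_scope.

(** The theorem is automatic continuity by a gliding hump, run on the
    localization that a biseparating map induces between the open sets of the
    two spaces.

    For V open in Y let [transport S V] be the union of the cozero sets of the
    T^-1 g with g supported in V; it plays the role of the image of V under the
    homeomorphism that T induces between the Stone-Cech compactifications, but
    is defined without any points at infinity.  Since T^-1 is separating,
    disjoint sets have disjoint transports ([transport_disjoint]).  Since T is
    separating, T is local: if f and f' agree on [transport S V], then T f and
    T f' agree on V ([separating_local]), because T (f - f') is disjoint from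
    every function supported in V.

    Cutoff functions can be transported as well.  For a continuous p : Y -> R,
    the transports of the sublevel sets {p < t} form a scale of open sets, as in
    the proof of Urysohn's lemma: a partition of unity shows that the transports
    of {p < b} and {p > a} cover X when a < b ([transport_cover]).  The function
    that the scale defines is continuous on X and separates the transport of
    {p < a} from the complement of the transport of {p < b}
    ([transport_cutoff]).

    Suppose now that T is unbounded.  As Y has no isolated points, every
    nonempty open set contains two disjoint nonempty open sets, and this lets
    one choose pairwise disjoint open sets V n and functions f n of norm at most
    1/(n+1) with T (f n) larger than n on V n ([gliding_hump]).  Multiplying f n
    by a transported cutoff makes it supported in [transport S (V n)] without
    changing it on the transport of a smaller nonempty open set U n.  The
    supports are then disjoint and the norms tend to 0, so the functions glue to
    a single bounded continuous s ([Cb_glue]); only finitely many of them matter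
    up to any given error, so no completeness of E is involved.  By locality
    T s = T (f n) on U n, hence T s is unbounded, a contradiction. *)

(** * The scalar field *)

(** Cutoff functions are built with real values and act on vectors through this
    embedding, which treats the two scalar fields uniformly. *)
Lemma real_or_complex_embedding (R : realType) (K : numFieldType) :
  real_or_complex R K ->
  exists2 i : {rmorphism R -> K}, continuous i &
    forall t, 0 <= t <= 1 -> `|i t| <= 1.
Proof.
case; first by exists idfun => [x|t /andP[t0 t1]] //=; rewrite ger0_norm.
exists (GRing.RMorphism.clone _ _ (real_complex R) _) => [x|t /andP[t0 t1]] /=; last first.
  by rewrite normc_def /= expr0n addr0 sqrtr_sqr ger0_norm // lecR.
apply/cvgrPdist_lt => e e0.
have er : (complex.Re e)%:C%C = e by rewrite RRe_real // realE (ltW e0).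
have re0 : 0 < complex.Re e by rewrite -ltcR er.
have /cvgrPdist_lt/(_ _ re0) : id t @[t --> x] --> x by exact: cvg_id.
apply: filterS => t xt.
by rewrite -rmorphB /= normc_def /= expr0n addr0 sqrtr_sqr -er ltcR.
Qed.

Lemma real_or_complex_archi (R : realType) (K : numFieldType) :
  real_or_complex R K -> forall x : K, exists n, `|x| < n%:R.
Proof.
case=> x.
  by exists (Num.bound `|x|); apply: archi_boundP.
exists (Num.bound (complex.Re `|x|)).
have <- : (complex.Re `|x|)%:C%C = `|x| by rewrite RRe_real // normr_real.
rewrite -(rmorph_nat (real_complex R)) ltcR; apply: archi_boundP.
by rewrite normc_def /= sqrtr_ge0.
Qed.

(** * Bounded continuous functions *)

Section Ramp.
Variables (R : realType) (a b : R).
Hypothesis ab : a < b.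

Definition ramp (t : R) : R := Num.max 0 (Num.min 1 ((b - t) / (b - a))).

Lemma ramp_continuous : continuous ramp.
Proof.
move=> t; apply: (@continuous_max R R (fun=> 0)
  (fun t => Num.min 1 ((b - t) / (b - a)))); first exact: cvg_cst.
apply: (@continuous_min R R (fun=> 1) (fun t => (b - t) / (b - a))); first exact: cvg_cst.
by apply: cvgMr_tmp; apply: cvgB; [exact: cvg_cst|exact: cvg_id].
Qed.

Lemma ramp01 t : 0 <= ramp t <= 1.
Proof. by rewrite /ramp le_max lexx /= ge_max ler01 ge_min lexx. Qed.

Lemma ramp1 t : t <= a -> ramp t = 1.
Proof.
move=> ta; rewrite /ramp min_l ?max_r ?ler01 //.
by rewrite ler_pdivlMr ?subr_gt0 // mul1r lerD2l lerN2.
Qed.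

Lemma ramp_neq0 t : ramp t != 0 -> t < b.
Proof.
apply: contraNT; rewrite -leNgt => bt; rewrite /ramp max_l // ge_min.
by rewrite pmulr_lle0 ?invr_gt0 ?subr_gt0 // subr_le0 bt orbT.
Qed.

Lemma ramp_neq1 t : 1 - ramp t != 0 -> a < t.
Proof.
by apply: contraNT; rewrite -leNgt => /ramp1 ->; rewrite subrr.
Qed.
End Ramp.

Section CbTheory.
Context {K : numFieldType} {Z : topologicalType} {E : normedModType K}.
Implicit Types f g : Cb Z E.

Lemma Cb_continuous f : continuous f.
Proof. by have /set_mem[] := valP f. Qed.

Lemma Cb_bounded f : exists2 M : K, 0 < M & forall z, `|f z| < M.
Proof.
have /set_mem[_ bf] := valP f.
by have [M M0 fM] := ex_strict_bound_gt0 bf; exists M => // z; exact: fM.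
Qed.

Lemma Cb_ext f g : f =1 g -> f = g.
Proof. by move=> fg; apply: val_inj; apply/funext. Qed.

(** When Z is inhabited, M dominates a norm and is therefore real, as
    boundedness requires; on an empty Z the bound 0 is used instead. *)
Lemma Cb_build (u : Z -> E) (M : K) : continuous u -> (forall z, `|u z| <= M) ->
  exists f : Cb Z E, f =1 u.
Proof.
move=> cu uM.
have uP : u \in @bounded_continuous K Z E.
  apply/mem_set; split => //.
  have [[z]|noZ] := pselect (exists z : Z, True).
    exists M; split; first by rewrite ger0_real // (le_trans _ (uM z)).
    by move=> r /ltW Mr x _; exact: le_trans Mr.
  by exists 0; split => // r _ x; case: noZ; exists x.
by exists (MkCb uP).
Qed.

Lemma Cb_sumE (f : nat -> Cb Z E) n z :
  (\sum_(i < n) f i : Cb Z E) z = \sum_(i < n) f i z.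
Proof.
elim: n => [|n IH]; first by rewrite !big_ord0.
by rewrite !big_ord_recr /= -IH.
Qed.

(** For complex scalars the half-line above a is not open in K, so this is not a
    preimage of an open set of scalars; the reverse triangle inequality gives it
    directly. *)
Lemma Cb_open_norm_gt f (a : K) : open [set z | a < `|f z|].
Proof.
rewrite openE => z az; have /cvgrPdist_lt := @Cb_continuous f z.
move=> /(_ (`|f z| - a)); rewrite subr_gt0 => /(_ az); apply: filterS => w zw /=.
by have := le_lt_trans (lerB_dist _ _) zw; rewrite ltrD2l ltrN2.
Qed.

Lemma Cb_open_neq0 f : open [set z | f z != 0].
Proof.
have -> : [set z | f z != 0] = [set z | 0 < `|f z|].
  by apply/funext => z; rewrite /= normr_gt0.
exact: Cb_open_norm_gt.
Qed.

End CbTheory.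

Section Glue.
Context {K : numFieldType} {Z : topologicalType} {E : normedModType K}.
Hypothesis archK : forall x : K, exists n, `|x| < n%:R.

Lemma archi_inv (e : K) : 0 < e -> exists n, n.+1%:R^-1 < e.
Proof.
move=> e0; have [n en] := archK e^-1; exists n.
rewrite invf_plt ?posrE ?ltr0n //; apply: le_lt_trans (real_ler_norm _) _.
  by rewrite realV gtr0_real.
by apply: lt_trans en _; rewrite ltr_nat.
Qed.

(** At each point at most one f n is nonzero, and the partial sums converge
    uniformly because the tail beyond N is bounded by 1/(N+1). *)
Lemma Cb_glue (W : nat -> set Z) (f : nat -> Cb Z E) :
  trivIset setT W -> (forall n z, `|f n z| <= n.+1%:R^-1) ->
  (forall n z, f n z != 0 -> W n z) ->
  exists s : Cb Z E, forall n z, W n z -> s z = f n z.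
Proof.
move=> trW fb fW.
pose u z : E := if pselect (exists n, W n z) is left h then f (sval (cid h)) z else 0.
have uW n z : W n z -> u z = f n z.
  move=> Wz; rewrite /u; case: pselect => [h|[]]; last by exists n.
  case: (cid h) => m /= Wm; congr (f _ z).
  by apply: trW => //; exists z.
have u0 z : (forall n, ~ W n z) -> u z = 0.
  by move=> h; rewrite /u; case: pselect => // hn; exfalso; case: hn => n; exact: h.
have f0 n z : ~ W n z -> f n z = 0.
  by move=> h; apply/eqP; apply: contra_notT h => /fW.
have uP N z : `|u z - (\sum_(i < N) f i : Cb Z E) z| <= N.+1%:R^-1.
  have N0 : 0 <= N.+1%:R^-1 :> K by rewrite invr_ge0.
  rewrite Cb_sumE; have [[n Wn]|h] := pselect (exists n, W n z); last first.
    rewrite u0; last by move=> n Wn; apply: h; exists n.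
    rewrite big1 ?subrr ?normr0 // => i _; apply: f0 => Wi; apply: h; by exists i.
  have fn m : m != n -> f m z = 0.
    move=> /eqP mn; apply: f0 => Wm; apply: mn.
    by apply: trW => //; exists z.
  rewrite (uW n) //; have [nN|Nn] := ltnP n N.
    rewrite (bigD1 (Ordinal nN)) //= big1 ?addr0 ?subrr ?normr0 // => i.
    by move=> /eqP ni; apply: fn; apply/eqP => im; apply: ni; apply: val_inj.
  rewrite big1 ?subr0; last by move=> i _; apply: fn; rewrite ltn_eqF // (leq_trans _ Nn).
  by apply: le_trans (fb _ _) _; rewrite lef_pV2 ?posrE ?ltr0n // ler_nat.
suff cu : continuous u.
  have [|s su] := @Cb_build _ _ _ u 1 cu; last by exists s => n z /uW <-; exact: su.
  move=> z; have := uP 0%N z.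
  by rewrite Cb_sumE big_ord0 subr0 invr1.
move=> z; apply/cvgrPdist_lt => e e0.
have e30 : 0 < e / 3 by rewrite divr_gt0.
have [N Ne] := archi_inv e30.
have /cvgrPdist_lt/(_ _ e30) := @Cb_continuous _ _ _ (\sum_(i < N) f i : Cb Z E) z.
have uN w : `|u w - (\sum_(i < N) f i : Cb Z E) w| < e / 3.
  exact: le_lt_trans (uP N w) Ne.
apply: filterS => w zw.
have -> : e = e / 3 + e / 3 + e / 3 by field.
apply: le_lt_trans (ler_distD ((\sum_(i < N) f i : Cb Z E) w) _ _) _.
apply: ltrD; last by rewrite distrC.
apply: le_lt_trans (ler_distD ((\sum_(i < N) f i : Cb Z E) z) _ _) _.
exact: ltrD.
Qed.
End Glue.

Section Scale.
Context {R : realType} {K : numFieldType} (i : {rmorphism R -> K}).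
Hypothesis ci : continuous i.
Hypothesis i_le1 : forall t, 0 <= t <= 1 -> `|i t| <= 1.

Lemma Cb_scale (Z : topologicalType) (E : normedModType K) (c : Z -> R)
    (f : Cb Z E) : continuous c -> (forall z, 0 <= c z <= 1) ->
  exists h : Cb Z E, forall z, h z = i (c z) *: f z.
Proof.
move=> cc c01; have [M M0 fM] := Cb_bounded f.
apply: (@Cb_build _ _ _ (fun z => i (c z) *: f z) M) => z.
  apply: cvgZ; last exact: Cb_continuous.
  by apply: continuous_comp; [exact: cc|exact: ci].
rewrite normrZ -[M]mul1r ler_pM //; first exact: i_le1.
exact: ltW.
Qed.

Lemma scale_neq0 (E : normedModType K) t (v : E) : i t *: v != 0 -> t != 0.
Proof. by apply: contraNneq => ->; rewrite rmorph0 scale0r. Qed.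

(** * Transport of open sets and of cutoffs along a biseparating map *)

Section Transport.
Context {X Y : topologicalType} {E F : normedModType K}.

Definition transport (S : Cb Y F -> Cb X E) (V : set Y) : set X :=
  [set x | exists2 g : Cb Y F, (forall y, g y != 0 -> V y) & S g x != 0].

Variable S : Cb Y F -> Cb X E.

Lemma transportS V V' : V `<=` V' -> transport S V `<=` transport S V'.
Proof. by move=> VV' x [g gV gx]; exists g => // y /gV/VV'. Qed.

Lemma transport_open V : open (transport S V).
Proof.
rewrite openE => x [g gV gx].
have : nbhs x [set z | S g z != 0].
  by apply: open_nbhs_nbhs; split => //; exact: Cb_open_neq0.
by apply: filterS => z gz; exists g.
Qed.

Lemma transport_disjoint V V' : separating S ->
  (forall y, V y -> V' y -> False) ->
  forall x, transport S V x -> transport S V' x -> False.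
Proof.
move=> sepS VV' x [g gV gx] [h hV hx].
suff gh y : `|g y| * `|h y| = 0.
  by have /eqP := sepS g h gh x; rewrite mulf_eq0 !normr_eq0 (negbTE gx) (negbTE hx).
apply/eqP; rewrite mulf_eq0 !normr_eq0 -[_ || _]negbK negb_or.
by apply/negP => /andP[/gV Vy /hV Vy2]; exact: VV' Vy Vy2.
Qed.

Variable T : {linear Cb X E -> Cb Y F}.
Hypotheses (TS : cancel T S) (ST : cancel S T).

Lemma inverseD g h : S (g + h) = S g + S h.
Proof. by apply: (can_inj TS); rewrite linearD !ST. Qed.

Lemma inverse0 : S 0 = 0.
Proof. by rewrite -(linear0 T) TS. Qed.

(** Split the preimage T f of a nonvanishing constant f as g + (T f - g), where
    g = (ramp a b o p) T f is supported in {p < b} and the rest in {a < p}; since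
    f x is nonzero, one of the two summands has a nonzero image at x. *)
Lemma transport_cover (x0 : E) (p : Y -> R) a b : x0 != 0 -> continuous p ->
  a < b -> forall x, transport S [set y | p y < b] x \/ transport S [set y | a < p y] x.
Proof.
move=> x00 cp ab x.
have [||f fE] := @Cb_build _ X _ (fun=> x0) `|x0|.
- by move=> z; exact: cvg_cst.
- by [].
have cr : continuous (ramp a b \o p).
  by move=> y; apply: continuous_comp; [exact: cp|exact: ramp_continuous].
have [g gE] := @Cb_scale Y F _ (T f) cr (fun y => ramp01 a b (p y)).
have := fE x; rewrite -[f]TS -[T f](subrK g) inverseD => fx.
have {}fx : S (T f - g) x + S g x = x0 := fx.
have [gx|] := eqVneq (S g x) 0; last first.
  by left; exists g => // y; rewrite gE => /scale_neq0 /(ramp_neq0 ab).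
right; exists (T f - g); last first.
  by move: fx; rewrite gx addr0 => ->.
move=> y gy; apply: (ramp_neq1 ab).
have gyE : (T f - g) y = i (1 - ramp a b (p y)) *: T f y.
  by rewrite rmorphB rmorph1 scalerBl scale1r -gE.
by move: gy; rewrite gyE => /scale_neq0.
Qed.

(** If T f and T f' differ at y in V, cut off T f - T f' to a function g
    supported in V with g y unchanged.  The function S g vanishes off the
    transport of V, so it is disjoint from f - f'; applying T shows that
    T f - T f' is disjoint from g, which is absurd at y. *)
Lemma separating_local V (f f' : Cb X E) : separating T ->
  completely_regular_space Y -> open V ->
  (forall x, transport S V x -> f x = f' x) -> forall y, V y -> T f y = T f' y.
Proof.
move=> sepT crY oV ff' y Vy.
have [p p0 pV] := @completely_regular_separation R Y y V crY (open_nbhs_nbhs (conj oV Vy)).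
have /set_mem[cp p01] := valP p.
have lt01 : (0 : R) < 1 := ltr01.
have cr : continuous (ramp 0 1 \o set_val p).
  by move=> z; apply: continuous_comp; [exact: cp|exact: ramp_continuous].
have [g gE] := @Cb_scale Y F _ (T f - T f') cr (fun y => ramp01 0 1 (set_val p y)).
have gV z : g z != 0 -> V z by rewrite gE => /scale_neq0 /(ramp_neq0 lt01) /pV.
have gy : g y = T f y - T f' y by rewrite gE /= p0 ramp1 // rmorph1 scale1r.
have := sepT (f - f') (S g); rewrite ST => /(_ _ y) h.
have /eqP : `|T (f - f') y| * `|g y| = 0.
  apply: h => x; have [gx|gx] := eqVneq (S g x) 0.
    by rewrite gx normr0 mulr0.
  have ffx : f x - f' x = 0 by rewrite ff' ?subrr //; exists g.
  by rewrite (ffx : (f - f') x = 0) normr0 mul0r.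
by rewrite gy linearB /= -expr2 expf_eq0 /= normr_eq0 subr_eq0 => /eqP.
Qed.

(** The transports of the sublevel sets {p < t} are open and increase with t;
    q x is the least level at which x is reached.  Upper semicontinuity of q is
    the openness of these transports.  Lower semicontinuity comes from the
    transports of the superlevel sets: they are open, disjoint from the lower
    transports, and together with them cover X. *)
Lemma transport_cutoff (x0 : E) (p : Y -> R) a b : separating S -> x0 != 0 ->
  continuous p -> (forall y, 0 <= p y <= 1) -> a < b ->
  exists c : X -> R, [/\ continuous c, forall x, 0 <= c x <= 1,
    forall x, transport S [set y | p y < a] x -> c x = 1 &
    forall x, c x != 0 -> transport S [set y | p y < b] x].
Proof.
move=> sepS x00 cp p01 ab.
pose A x : set R := [set t | transport S [set y | p y < t] x].
pose q x : R := inf (A x).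
have A0 x : A x !=set0.
  exists 2; have [//|[g _ gx]] := transport_cover x00 cp ab x.
    by apply: transportS => y _ /=; have /andP[_] := p01 y; lra.
  by exists g => // y _ /=; have /andP[_] := p01 y; lra.
have lbA x : lbound (A x) 0.
  move=> t [g gt gx]; rewrite leNgt; apply/negP => t0.
  have g0 : g = 0.
    apply: Cb_ext => y; apply/eqP; apply/negPn/negP => /gt /=.
    by have /andP[+ _] := p01 y; lra.
  by move: gx; rewrite g0 inverse0 /= eqxx.
have q_lt x t : q x < t -> A x t.
  move=> /(inf_lt (A0 x))[s As st].
  by apply: transportS As => y /= ys; exact: lt_trans st.
have q_le x t : A x t -> q x <= t.
  by move=> At; apply: ge_inf => //; exists 0; exact: lbA.
have cq : continuous q.
  move=> x; apply/cvgrPdist_lt => e e0.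
  have up : nbhs x (A^~ (q x + e / 2)).
    apply: open_nbhs_nbhs; split; first exact: transport_open.
    by apply: q_lt; lra.
  (* x is not in the transport at level q x - e / 3, so by the covering property
     it lies in the transport of a slightly larger superlevel set *)
  have lo : nbhs x (transport S [set y | q x - e * 2 / 3 < p y]).
    apply: open_nbhs_nbhs; split; first exact: transport_open.
    have [||//] := @transport_cover x0 p (q x - e * 2 / 3) (q x - e / 3) x00 cp _ x; first by lra.
    by move=> /q_le; lra.
  apply: filterS2 up lo => z /q_le zu zl.
  have : q x - e * 2 / 3 <= q z.
    rewrite leNgt; apply/negP => /q_lt zA.
    by apply: (transport_disjoint sepS _ zA zl) => y /=; lra.
  by move=> zl'; rewrite ltr_norml; lra.
exists (ramp a b \o q); split.
- by move=> x; apply: continuous_comp; [exact: cq|exact: ramp_continuous].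
- by move=> x; exact: ramp01.
- by move=> x /q_le xa; exact: ramp1.
- by move=> x /= /(ramp_neq0 ab) /q_lt.
Qed.

End Transport.
End Scale.

(** * Continuity and boundedness of linear maps *)

Section Topology.
Context {K : numFieldType}.

Lemma Cb_nbhsP (Z : topologicalType) (E : normedModType K) (f : Cb Z E)
    (U : set (Cb Z E)) :
  nbhs f U <-> exists2 e : K, 0 < e &
    [set g : Cb Z E | forall z, `|f z - g z| < e] `<=` U.
Proof.
split.
- move=> [_ [[W oW <-] Wf WU]].
  have /uniform_nbhs[D [eD DW]] := open_nbhs_nbhs (conj oW Wf).
  move: eD; rewrite -entourage_ballE => -[e /= e0 eD].
  exists e => // g fg; apply: WU; apply: DW => z _; apply: eD.
  by rewrite /= -ball_normE /=; exact: fg.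
- move=> [e e0 eU].
  have := @initial_continuous _ {uniform Z -> E} (@Cb_val K Z E) f
    [set h | forall z, ball (f z) e (h z)].
  move=> H; suff : nbhs f [set g : Cb Z E | forall z, ball (f z) e (g z)].
    by apply: filterS => g fg; apply: eU => z; have := fg z; rewrite -ball_normE.
  apply: H; apply/uniform_nbhs; exists [set uv | ball uv.1 e uv.2].
  by split; [exact: (entourage_ball _ (PosNum e0))|move=> h /= hz z; exact: hz].
Qed.

Lemma Cb_linear_continuous (X Y : topologicalType) (E F : normedModType K)
    (T : {linear Cb X E -> Cb Y F}) (d M : K) : 0 < d -> 0 < M ->
  (forall f : Cb X E, (forall x, `|f x| <= d) -> forall y, `|T f y| <= M) ->
  continuous T.
Proof.
move=> d0 M0 bT f U /Cb_nbhsP[e e0 eU].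
apply/Cb_nbhsP; exists (d * (e / (2 * M))).
  by rewrite mulr_gt0 // divr_gt0 // mulr_gt0.
move=> g fg; apply: eU => y.
pose c := e / (2 * M).
have c0 : 0 < c by rewrite divr_gt0 // mulr_gt0.
have -> : T f y - T g y = c *: T (c^-1 *: (f - g)) y.
  by rewrite -[RHS]/((c *: T (c^-1 *: (f - g)) : Cb Y F) y) linearZ scalerA divff ?gt_eqF //
    scale1r linearB.
rewrite normrZ gtr0_norm //; apply: (@le_lt_trans _ _ (c * M)).
  rewrite ler_pM2l //; apply: bT => x; rewrite /= normrZ normfV gtr0_norm //.
  by rewrite ler_pdivrMl // mulrC; apply/ltW; exact: fg.
rewrite /c invfM -!mulrA mulVf ?gt_eqF // mulr1 gtr_pMr // invf_lt1 ?ltr1n //.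
Qed.
End Topology.

(** * The gliding hump *)

Section GlidingHump.
Context {K : numFieldType} {X Y : topologicalType} {E F : normedModType K}.
Variable T : Cb X E -> Cb Y F.

(** Bounding the norm of f by 1/(n+1) rather than by 1 builds in the decay that
    the gluing of the humps requires. *)
Definition unbounded_on (O : set Y) : Prop := forall n : nat,
  exists2 f : Cb X E, (forall x, `|f x| <= n.+1%:R^-1) &
    exists2 y, O y & n%:R < `|T f y|.

(** The condition defining [unbounded_on] gets stronger with n, so if it failed
    on A for some m and on B for some n, it would fail on O for the maximum.  As
    the sets where T f is large are open, it is enough that the union of A and B
    is dense in O; the first hypothesis is what density is used for. *)
Lemma unbounded_split (O A B : set Y) :
  (forall f : Cb X E, forall a : K, (exists2 y, O y & a < `|T f y|) ->
     exists2 y, (A `|` B) y & a < `|T f y|) ->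
  unbounded_on O -> unbounded_on A \/ unbounded_on B.
Proof.
move=> OAB uO; apply: contrapT => /not_orP[/existsNP[m nA] /existsNP[n nB]].
have [f fb /OAB[y ABy fy]] := uO (maxn m n).
have fbk k : (k <= maxn m n)%N -> forall x, `|f x| <= k.+1%:R^-1.
  by move=> kn x; rewrite (le_trans (fb x)) // lef_pV2 ?posrE ?ltr0n // ler_nat.
have fyk k : (k <= maxn m n)%N -> k%:R < `|T f y|.
  by move=> kn; rewrite (le_lt_trans _ fy) // ler_nat.
case: ABy => [Ay|By]; [apply: nA|apply: nB]; exists f;
  by [apply: fbk; rewrite leq_max leqnn ?orbT|
      exists y => //; apply: fyk; rewrite leq_max leqnn ?orbT].
Qed.

Hypotheses (hY : hausdorff_space Y) (isoY : isolated [set: Y] = set0).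

Lemma two_open (O : set Y) : open O -> O !=set0 ->
  exists A B : set Y, [/\ open A, open B, A !=set0, B !=set0 &
    [/\ A `<=` O, B `<=` O & forall y, A y -> B y -> False]].
Proof.
move=> oO [y Oy].
have [z Oz zy] : exists2 z, O z & z != y.
  apply: contrapT => h; have : isolated [set: Y] y.
    split; first exact: in_setT.
    exists O; first exact: open_nbhs_nbhs.
    rewrite setIT; apply/seteqP; split => [z Oz|z ->] //=.
    by apply/eqP/negPn/negP => zy; apply: h; exists z.
  by rewrite isoY.
move: hY; rewrite open_hausdorff => /(_ _ _ zy)[[A B] /= [/set_mem zA /set_mem yB] [oA oB /eqP AB]].
exists (A `&` O), (B `&` O); split; [exact: openI|exact: openI|by exists z|by exists y|].
split; [by move=> ? []|by move=> ? []|].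
by move=> w [Aw _] [Bw _]; have : set0 w by rewrite -AB.
Qed.

(** Choose two disjoint nonempty open sets A and B on which T f is large.  The
    union of A and of the complement of its closure is dense, so T stays
    unbounded on one of them.  If it is A, the hump is placed on B and the
    construction goes on in A; otherwise the hump is placed on A and the
    construction goes on outside its closure. *)
Lemma hump_step (n : nat) (O : set Y) : open O -> unbounded_on O ->
  exists fVO : Cb X E * set Y * set Y, let: (f, V, O') := fVO in
  [/\ forall x, `|f x| <= n.+1%:R^-1, open V, V !=set0, V `<=` O &
    forall y, V y -> n%:R < `|T f y|] /\
  [/\ open O', unbounded_on O', O' `<=` O & forall y, V y -> O' y -> False].
Proof.
move=> oO uO; have [f fb [y Oy fy]] := uO n.
pose U := O `&` [set y | n%:R < `|T f y|].
have oU : open U by apply: openI => //; exact: Cb_open_norm_gt.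
have [A [B [oA oB A0 B0 [AU BU AB]]]] := two_open oU (ex_intro _ y (conj Oy fy)).
have [uA|uC] : unbounded_on A \/ unbounded_on (O `&` ~` closure A).
- apply: unbounded_split uO => g a [z Oz gz].
  have [clA|nclA] := pselect (closure A z); last by exists z => //; right.
  have [w [Aw gw]] := clA _ (open_nbhs_nbhs (conj (Cb_open_norm_gt (T g) a) gz)).
  by exists w => //; left.
- exists (f, B, A); split; split => //; first by move=> z /BU[].
  + by move=> z /BU[].
  + by move=> z /AU[].
  + by move=> z Bz Az; exact: AB Az Bz.
- exists (f, A, O `&` ~` closure A); split; split => //.
  + by move=> z /AU[].
  + by move=> z /AU[].
  + by apply: openI => //; exact/closed_openC/closed_closure.
  + by move=> z Az [_]; apply; exact: subset_closure.
Qed.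

Lemma gliding_hump : unbounded_on setT ->
  exists (f : nat -> Cb X E) (V : nat -> set Y),
  [/\ forall n x, `|f n x| <= n.+1%:R^-1, forall n, open (V n),
      forall n, V n !=set0, trivIset setT V &
      forall n y, V n y -> n%:R < `|T (f n) y|].
Proof.
move=> uT.
have /choice[step stepP] : forall nO : nat * set Y,
    exists fVO : Cb X E * set Y * set Y, open nO.2 -> unbounded_on nO.2 ->
  [/\ forall x, `|fVO.1.1 x| <= nO.1.+1%:R^-1, open fVO.1.2, fVO.1.2 !=set0,
    fVO.1.2 `<=` nO.2 & forall y, fVO.1.2 y -> nO.1%:R < `|T fVO.1.1 y|] /\
  [/\ open fVO.2, unbounded_on fVO.2, fVO.2 `<=` nO.2 &
    forall y, fVO.1.2 y -> fVO.2 y -> False].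
  move=> [n O]; have [[oO uO]|h] := pselect (open O /\ unbounded_on O).
    by have [[[f V] O'] fVO] := hump_step n oO uO; exists (f, V, O').
  by exists (0, set0, set0) => oO uO; case: h.
pose O := fix O n := if n is m.+1 then (step (m, O m)).2 else [set: Y].
have OP n : open (O n) /\ unbounded_on (O n).
  elim: n => [|n [oO uO]]; first by split => //; exact: openT.
  by have [_ []] := stepP (n, O n) oO uO.
have sP n := stepP (n, O n) (OP n).1 (OP n).2.
have Omono m n : (m <= n)%N -> O n `<=` O m.
  elim: n => [|n IH]; first by rewrite leqn0 => /eqP ->.
  rewrite leq_eqVlt => /predU1P[->//|/IH mn].
  by apply: subset_trans mn; have [_ []] := sP n.
exists (fun n => (step (n, O n)).1.1), (fun n => (step (n, O n)).1.2).
split; try by move=> n; have [[]] := sP n.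
apply: ltn_trivIset => n m mn; apply/seteqP; split => // y [Vm Vn].
have [_ [_ _ _ dis]] := sP m.
have [[_ _ _ VO _] _] := sP n.
by apply: (dis y) => //; exact: (Omono m.+1 n mn y (VO y Vn)).
Qed.
End GlidingHump.

(** * Automatic continuity *)

Theorem theorem2 (R : realType) (K : numFieldType) (hK : real_or_complex R K)
  (X Y : topologicalType)
  (hX : hausdorff_space X) (crX : completely_regular_space X)
  (rcX : realcompact R K X)
  (hY : hausdorff_space Y) (crY : completely_regular_space Y)
  (rcY : realcompact R K Y)
  (E F : normedModType K)
  (T : {linear Cb X E -> Cb Y F}) (hT : biseparating T)
  (isoY : isolated [set: Y] = set0) :
  continuous T.
Proof.
have [i ci i_le1] := real_or_complex_embedding hK.
have archK := real_or_complex_archi hK.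
have [sepT [S [TS ST sepS]]] := hT.
have [uT|/existsNP[n nuT]] := pselect (unbounded_on T setT); last first.
  apply: (@Cb_linear_continuous _ _ _ _ _ T n.+1%:R^-1 n.+1%:R) => //.
  move=> f fb y; rewrite real_leNgt ?realn //; apply/negP => ny; apply: nuT.
  by exists f => //; exists y => //; apply: lt_trans ny; rewrite ltr_nat.
exfalso.
have [f [V [fb oV V0 trV TfV]]] := gliding_hump hY isoY uT.
have [x0 x00] : exists x0 : E, x0 != 0.
  have [y Vy] := V0 0%N; apply: contrapT => E0.
  have f0 : f 0%N = 0.
    apply: Cb_ext => x; apply/eqP/negPn/negP => fx.
    by apply: E0; exists (f 0%N x).
  by have := TfV 0%N y Vy; rewrite f0 linear0 /= normr0 ltxx.
(* hU.1 is the truncation of f n to the transport of V n, and hU.2 is the open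
   set over whose transport the cutoff equals 1 *)
have /choice[hU hUP] : forall n, exists hU : Cb X E * set Y,
    [/\ forall x, `|hU.1 x| <= n.+1%:R^-1,
      forall x, hU.1 x != 0 -> transport S (V n) x &
      [/\ hU.2 `<=` V n, open hU.2, hU.2 !=set0 &
      forall x, transport S hU.2 x -> hU.1 x = f n x]].
  move=> n; have [y Vy] := V0 n.
  have [p p0 pV] := @completely_regular_separation R Y y (V n) crY
    (open_nbhs_nbhs (conj (oV n) Vy)).
  have /set_mem[cp p01] := valP p.
  have lt12 : 1 / 3 < 2 / 3 :> R by lra.
  have [c [cc c01 c1 cV]] :=
    transport_cutoff ci i_le1 TS ST sepS x00 cp p01 lt12.
  have [h hE] := Cb_scale ci i_le1 (f n) cc c01.
  exists (h, [set y | set_val p y < 1 / 3]); split => /=; last split => /=.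
  - move=> x; rewrite hE normrZ (le_trans _ (fb n x)) // ler_piMl //.
    exact: i_le1.
  - move=> x; rewrite hE => /scale_neq0/cV; apply: transportS => z /= pz.
    by apply: pV; apply: lt_trans pz _; lra.
  - by move=> z pz; apply: pV; apply: lt_trans pz _; lra.
  - by apply: (@open_comp _ _ (set_val p) [set t | t < 1 / 3]) => //; exact: open_lt.
  - by exists y => /=; rewrite p0; lra.
  - by move=> x /c1 cx; rewrite hE cx rmorph1 scale1r.
have trW : trivIset setT (fun n => transport S (V n)).
  move=> m n _ _ [x [Wm Wn]]; apply: contrapT => mn.
  apply: (transport_disjoint sepS _ Wm Wn) => y Vm Vn.
  by apply: mn; apply: trV => //; exists y.
have hb n x : `|(hU n).1 x| <= n.+1%:R^-1 by have [] := hUP n.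
have hW n x : (hU n).1 x != 0 -> transport S (V n) x.
  by have [_ + _] := hUP n; apply.
have [s sE] := Cb_glue archK trW hb hW.
have [M M0 TsM] := Cb_bounded (T s).
have [n Mn] := archK M.
have [_ _ [UV oU [y Uy] hf]] := hUP n.
have sf : T s y = T (f n) y.
  apply: (separating_local ci i_le1 ST sepT crY oU _ Uy) => x Ux.
  by rewrite (sE n) ?hf //; exact: transportS Ux.
have ny : n%:R < `|T s y| by rewrite sf; apply: TfV; exact: UV.
move: Mn; rewrite gtr0_norm // => Mn.
by have := lt_trans (lt_trans ny (TsM y)) Mn; rewrite ltxx.
Qed.
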